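(* Consider a convex multiobjective optimization problem $\min (f_1(x),\dots,f_m(x))$ subject to $c_1(x)\ge 0,\dots,c_l(x)\ge 0$ in $x\in\mathbb{R}^n$, where all $f_j$ are convex real polynomials and all $c_i$ are concave real polynomials. Let $\mathcal{WP}$ be its weakly Pareto set. Suppose the matrix polynomial $C(x)$ (defined in the context) is nonsingular, i.e. $\operatorname{rank}C(x)=l$ for all $x\in\mathbb{C}^n$; let $C'(x)\in\mathbb{R}[x]^{l\times(n+l)}$ satisfy $C'(x)C(x)=I_l$, let $\ell_i(x)^T$ be the $i$th row of the submatrix formed by the first $n$ columns of $C'(x)$, and put $u_{ij}(x)=\ell_i(x)^T\nabla f_j(x)$. Suppose moreover that the $(n+l+1)\times m$ matrix polynomial $$P(x)=\begin{bmatrix}\sum_{i=1}^l u_{i1}(x)\nabla c_i(x)-\nabla f_1(x)&\cdots&\sum_{i=1}^l u_{im}(x)\nabla c_i(x)-\nabla f_m(x)\\ u_{11}(x)c_1(x)&\cdots&u_{1m}(x)c_1(x)\\ \vdots&&\vdots\\ u_{l1}(x)c_l(x)&\cdots&u_{lm}(x)c_l(x)\\ 1&\cdots&1\end{bmatrix}$$ is nonsingular, i.e. $\operatorname{rank}P(x)=m$ for all $x\in\mathbb{C}^n$, and let $P'(x)\in\mathbb{R}[x]^{m\times(n+l+1)}$ satisfy $P'(x)P(x)=I_m$. Put $$w(x)=(w_1(x),\dots,w_m(x))=P'(x)e_{n+l+1},\qquad \lambda_i(x)=\sum_{j=1}^m w_j(x)u_{ij}(x)\quad(i=1,\dots,l).$$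 Then $\mathcal{WP}$ equals the set of all $x\in\mathbb{R}^n$ such that $$\sum_{j=1}^m w_j(x)\nabla f_j(x)=\sum_{i=1}^l\lambda_i(x)\nabla c_i(x),$$ $$\lambda_i(x)\ge 0,\quad c_i(x)\ge 0,\quad \lambda_i(x)c_i(x)=0\quad(i=1,\dots,l),$$ $$w_1(x)\ge 0,\dots,w_m(x)\ge 0,\quad w_1(x)+\cdots+w_m(x)=1.$$
   Context: Let $K=\{x\in\mathbb{R}^n: c_1(x)\ge 0,\dots,c_l(x)\ge 0\}$. A point $x^*\in K$ is a weakly Pareto point if there is no $x\in K$ with $f_i(x)<f_i(x^* )$ for all $i=1,\dots,m$; the weakly Pareto set $\mathcal{WP}$ is the set of all weakly Pareto points. The matrix polynomial $C(x)$ is the $(n+l)\times l$ matrix whose top $n\times l$ block is $[\nabla c_1(x)\ \cdots\ \nabla c_l(x)]$ and whose bottom $l\times l$ block is $\operatorname{diag}(c_1(x),\dots,c_l(x))$. $e_{n+l+1}$ is the last standard unit vector of $\mathbb{R}^{n+l+1}$. Under the nonsingularity assumptions, matrix polynomials $C'(x)$ and $P'(x)$ with the stated properties exist. *)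

(* Defs.v *)
From HB Require Import structures.
From mathcomp Require Import all_boot all_order all_algebra.
From mathcomp Require Import mpoly complex.
From mathcomp Require Import boolp classical_sets reals.
(* convex is not imported: mathcomp-analysis notations clash with mpoly's. *)
From mathcomp Require convex.

Set Implicit Arguments.
Unset Strict Implicit.
Unset Printing Implicit Defensive.

Import Order.TTheory GRing.Theory Num.Theory.

Local Open Scope classical_set_scope.
Local Open Scope ring_scope.

Section Defs.
Variables (R : realType) (n : nat).
Implicit Types (p : {mpoly R[n]}) (x : 'cV[R]_n).

Definition peval p x : R := p.@[fun k => x k 0].

Definition pevalC p (z : 'cV[R[i]]_n) : R[i] :=
  (map_mpoly (real_complex R) p).@[fun k => z k 0].

Definition convex_mpoly p : Prop :=
  convex.convex_function [set: convex.convex_lmodType 'cV[R]_n] (peval p).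

Definition concave_mpoly p : Prop :=
  convex.convex_function [set: convex.convex_lmodType 'cV[R]_n]
    (fun x => - peval p x).

Definition grad p : 'cV[{mpoly R[n]}]_n := \col_k p^`M(k).

Definition grad_at p x : 'cV[R]_n := map_mx (fun q => peval q x) (grad p).

(* Full column rank at every complex point, not only at the real ones. *)
Definition nonsingular_mpmx (r s : nat) (A : 'M[{mpoly R[n]}]_(r, s)) : Prop :=
  forall z : 'cV[R[i]]_n, \rank (map_mx (fun q => pevalC q z) A) = s.

Definition feasible_set (l : nat) (c : 'I_l -> {mpoly R[n]}) : set 'cV[R]_n :=
  [set x | forall i, 0 <= peval (c i) x].

Definition weakly_pareto_set (m l : nat) (f : 'I_m -> {mpoly R[n]})
    (c : 'I_l -> {mpoly R[n]}) : set 'cV[R]_n :=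
  [set x | feasible_set c x /\
    ~ (exists y, feasible_set c y /\
         forall j, peval (f j) y < peval (f j) x)].

Definition constraint_mx (l : nat) (c : 'I_l -> {mpoly R[n]}) :
    'M[{mpoly R[n]}]_(n + l, l) :=
  col_mx (\matrix_(k, i) grad (c i) k 0) (diag_mx (\row_i c i)).

Section Multipliers.
Variables (m l : nat).
Variables (f : 'I_m -> {mpoly R[n]}) (c : 'I_l -> {mpoly R[n]}).
Variable C' : 'M[{mpoly R[n]}]_(l, n + l).

Definition u_poly (i : 'I_l) (j : 'I_m) : {mpoly R[n]} :=
  (row i (lsubmx C') *m grad (f j)) 0 0.

Definition pareto_mx : 'M[{mpoly R[n]}]_(n + l + 1, m) :=
  col_mx
    (col_mx
      (\matrix_(k, j)
         (\sum_(i < l) u_poly i j *: grad (c i) - grad (f j)) k 0)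
      (\matrix_(i, j) (u_poly i j * c i)))
    (const_mx 1).

Variable P' : 'M[{mpoly R[n]}]_(m, n + l + 1).

Definition w_poly (j : 'I_m) : {mpoly R[n]} :=
  (P' *m delta_mx (rshift (n + l) ord0) 0 : 'cV_m) j 0.

Definition lambda_poly (i : 'I_l) : {mpoly R[n]} :=
  \sum_(j < m) w_poly j * u_poly i j.

End Multipliers.
End Defs.

(* Main.v *)
Require Import Defs.
From HB Require Import structures.
From mathcomp Require Import all_boot all_order all_algebra.
From mathcomp Require Import mpoly complex.
From mathcomp Require Import boolp classical_sets reals.
From mathcomp Require Import interval_inference ring lra.

(* At a weakly Pareto point no direction strictly decreases all [f j] and
   strictly increases all active [c i] to first order, so Gordan's theorem of
   the alternative yields nonnegative, not all zero, weights [w] and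
   multipliers [y] of Fritz John type.  The identity [C' C = 1] forces
   [y i = \sum_j w j * u_ij], so [w] is nonzero and can be normalised; then
   [P(x) w] is the last unit vector, and [P' P = 1] gives [w = w(x)].
   Conversely, the first-order inequalities for convex functions make the KKT
   conditions sufficient. *)

Set Implicit Arguments.
Unset Strict Implicit.
Unset Printing Implicit Defensive.

Import Order.TTheory GRing.Theory Num.Theory.

Local Open Scope classical_set_scope.
Local Open Scope ring_scope.

(** * Gordan's theorem of the alternative over an ordered field *)

Section Gordan.
Variables (R : realFieldType) (n : nat).
Implicit Types (a d u v : 'cV[R]_n).

Definition dot u v : R := \sum_k u k 0 * v k 0.

Lemma dotDl u v d : dot (u + v) d = dot u d + dot v d.
Proof. by rewrite -big_split; apply: eq_bigr => k _; rewrite mxE mulrDl. Qed.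

Lemma dotZl (t : R) u d : dot (t *: u) d = t * dot u d.
Proof. by rewrite mulr_sumr; apply: eq_bigr => k _; rewrite mxE mulrA. Qed.

Lemma dotC u v : dot u v = dot v u.
Proof. by apply: eq_bigr => k _; rewrite mulrC. Qed.

Lemma dotDr u v d : dot d (u + v) = dot d u + dot d v.
Proof. by rewrite dotC dotDl !(dotC d). Qed.

Lemma dotZr (t : R) u d : dot d (t *: u) = t * dot d u.
Proof. by rewrite dotC dotZl dotC. Qed.

Lemma dot0l d : dot 0 d = 0.
Proof. by rewrite -(scale0r 0) dotZl mul0r. Qed.

Lemma dotNl u d : dot (- u) d = - dot u d.
Proof. by rewrite -scaleN1r dotZl mulN1r. Qed.

Lemma dot_suml (I : Type) (s : seq I) (P : pred I) (F : I -> 'cV[R]_n) d :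
  dot (\sum_(i <- s | P i) F i) d = \sum_(i <- s | P i) dot (F i) d.
Proof.
by apply: (big_morph (dot^~ d)) => [u v|]; rewrite ?dotDl ?dot0l.
Qed.

Lemma dot_gt0 u : u != 0 -> 0 < dot u u.
Proof.
move=> u0; have [k uk0] : exists k, u k 0 != 0.
  apply/existsP; apply: contra_neqT u0; rewrite negb_exists => /forallP u0.
  by apply/colP => k; rewrite mxE; apply/eqP; rewrite -[_ == _]negbK u0.
rewrite /dot (bigD1 k) //= ltr_wpDr ?sumr_ge0 // => [i _|].
  by rewrite -expr2 sqr_ge0.
by rewrite -expr2 exprn_even_gt0.
Qed.

(** Taking the minimum of finitely many thresholds moves [for all small t > 0] outside a quantifier
    over a finite list. *)
Lemma small_forall (I : eqType) (s : seq I) (P : I -> R -> Prop) :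
  (forall i, i \in s ->
     exists2 e, 0 < e & forall t, 0 < t -> t <= e -> P i t) ->
  exists2 e, 0 < e & forall i t, i \in s -> 0 < t -> t <= e -> P i t.
Proof.
elim: s => [|j s IH] Ps; first by exists 1.
have [i si|e e0 Pe] := IH; first by apply: Ps; rewrite inE si orbT.
have [e' e'0 Pe'] := Ps j (mem_head j s).
exists (Num.min e e'); first by rewrite lt_min e0.
move=> i t; rewrite inE le_min => /predU1P[->|si] t0 /andP[te te'].
  exact: Pe'.
exact: Pe.
Qed.

Lemma small_affine_gt0 (b g : R) :
  0 < b -> exists2 e, 0 < e & forall t, 0 < t -> t <= e -> 0 < b + t * g.
Proof.
move=> b0; have g0 : 0 < 1 + `|g| by rewrite ltr_wpDr.
(* The summand 1 keeps the denominator positive when [g = 0] and makes the bound strict: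
   [t * |g| <= b - t < b]. *)
exists (b / (1 + `|g|)); first exact: divr_gt0.
move=> t t0; rewrite ler_pdivlMr // => tb.
have : t * - `|g| <= t * g by rewrite ler_pM2l // lerNl ler_normr lexx orbT.
lra.
Qed.

(* If [d] works for all of [s] but [a i . d < 0], shear the [a j] along [a i]
   so that they become orthogonal to [d] and apply the induction hypothesis
   again. *)
Lemma gordan (I : eqType) (s : seq I) (a : I -> 'cV[R]_n) : uniq s ->
  (exists d, forall i, i \in s -> 0 < dot (a i) d) \/
  (exists y : I -> R, [/\ forall i, 0 <= y i,
     exists2 i, i \in s & 0 < y i & \sum_(i <- s) y i *: a i = 0]).
Proof.
elim: s a => [|i s IH] a /=; first by left; exists 0.
move=> /andP[si us].
have sni j : j \in s -> j != i by apply: contraTneq => ->.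
have extend (y : I -> R) (z : R) : (forall j, 0 <= y j) -> 0 <= z ->
    0 < z \/ (exists2 j, j \in s & 0 < y j) ->
    z *: a i + \sum_(j <- s) y j *: a j = 0 ->
    exists y' : I -> R, [/\ forall j, 0 <= y' j,
     exists2 j, j \in i :: s & 0 < y' j & \sum_(j <- i :: s) y' j *: a j = 0].
  move=> y0 z0 yz sum0; exists (fun j => if j == i then z else y j); split.
  - by move=> j; case: ifP.
  - case: yz => [zp|[j js yj]]; first by exists i; rewrite ?mem_head ?eqxx.
    by exists j; rewrite ?inE ?js ?orbT // (negPf (sni _ js)).
  - rewrite big_cons eqxx -[RHS]sum0; congr (_ + _).
    by apply: eq_big_seq => j /sni /negPf ->.
have [ai0|ai0] := eqVneq (a i) 0.
  right; apply: (extend (fun=> 0) 1) => //; first by left.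
  by rewrite ai0 scaler0 big1 ?addr0 // => j _; rewrite scale0r.
(* Since [a i] is nonzero, a small move of [d] along [a i] makes the weak inequality strict and
   preserves the finitely many strict ones. *)
have perturb d : 0 <= dot (a i) d -> (forall j, j \in s -> 0 < dot (a j) d) ->
    exists d, forall j, j \in i :: s -> 0 < dot (a j) d.
  move=> id sd.
  have [j js|e e0 Pe] := @small_forall _ s
    (fun j t => 0 < dot (a j) d + t * dot (a j) (a i)).
    exact/small_affine_gt0/sd.
  exists (d + e *: a i) => j; rewrite inE dotDr dotZr => /predU1P[->|js].
    by rewrite ltr_wpDl // mulr_gt0 // dot_gt0.
  exact: Pe.
case: (IH a us) => [[d sd]|[y [y0 yp sum0]]]; last first.
  by right; apply: (extend y 0); rewrite ?scale0r ?add0r //; right.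
have [id|id] := lerP 0 (dot (a i) d); first by left; apply: perturb sd.
(* Chosen so that [a j + t j *: a i] is orthogonal to [d]; the signs make [t j] positive, so
   coefficients stay nonnegative when the shear is undone. *)
pose t j := - (dot (a j) d / dot (a i) d).
have t0 j : j \in s -> 0 < t j.
  by move=> /sd jd; rewrite oppr_gt0 pmulr_rlt0 // invr_lt0.
have [[e se]|[y [y0 [j js yj] sum0]]] := IH (fun j => a j + t j *: a i) us.
  (* Chosen so that [e + q *: d] is orthogonal to [a i]; on it [a j] takes the value that the
     sheared vector takes on [e]. *)
  left; pose q := - (dot (a i) e / dot (a i) d).
  have ie : dot (a i) (e + q *: d) = 0.
    by rewrite dotDr dotZr /q; field; rewrite lt_eqF.
  apply: (perturb (e + q *: d)); first by rewrite ie.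
  move=> j js; have := se _ js; rewrite dotDl dotZl dotDr dotZr.
  suff -> : t j * dot (a i) e = q * dot (a j) d by [].
  by rewrite /q /t; field; rewrite lt_eqF.
right; apply: (extend y (\sum_(j <- s) y j * t j)) => //.
- by rewrite big_seq sumr_ge0 // => k ks; rewrite mulr_ge0 // ltW // t0.
- by right; exists j.
- rewrite scaler_suml -big_split -[RHS]sum0; apply: eq_bigr => k _ /=.
  by rewrite scalerDr scalerA addrC.
Qed.

End Gordan.

(** * Polynomials along a line, and first-order convexity inequalities *)

Section Line.
Variables (R : realType) (n : nat).
Implicit Types (p q : {mpoly R[n]}) (x d : 'cV[R]_n).

Lemma dot_grad_at p x d :
  dot (grad_at p x) d = \sum_k peval p^`M(k) x * d k 0.
Proof. by apply: eq_bigr => k _; rewrite !mxE. Qed.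

Lemma pevalD p q x : peval (p + q) x = peval p x + peval q x.
Proof. exact: mevalD. Qed.

Lemma pevalM p q x : peval (p * q) x = peval p x * peval q x.
Proof. exact: mevalM. Qed.

(** Requiring the remainder to be a polynomial in [t] makes closure under products purely algebraic
    and bounds it on the unit interval. *)
Let expansion x d p := exists r : {poly R}, forall t,
  peval p (x + t *: d)
  = peval p x + t * dot (grad_at p x) d + t ^+ 2 * r.[t].

Let expansionC x d (b : R) : expansion x d b%:MP.
Proof.
exists 0 => t; rewrite dot_grad_at big1 => [|k _].
  by rewrite horner0 !mulr0 !addr0 /peval !mevalC.
by rewrite mderivC /peval meval0 mul0r.
Qed.

Let expansionX x d k : expansion x d 'X_k.
Proof.
exists 0 => t; rewrite horner0 mulr0 addr0 dot_grad_at /peval.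
rewrite (bigD1 k) //= big1 => [|j jk].
  rewrite !mevalXU !mxE mderivX mnm1E eqxx scale1r.
  have -> : (U_(k) - U_(k) = 0)%MM by apply/mnmP => i; rewrite !mnmE subnn.
  by rewrite mpolyX0 meval1 mul1r addr0.
by rewrite mderivX mnm1E eq_sym (negPf jk) scale0r meval0 mul0r.
Qed.

Let expansionD x d p q :
  expansion x d p -> expansion x d q -> expansion x d (p + q).
Proof.
move=> [r rP] [s sP]; exists (r + s) => t; rewrite !pevalD rP sP hornerD.
have -> : dot (grad_at (p + q) x) d
    = dot (grad_at p x) d + dot (grad_at q x) d.
  rewrite !dot_grad_at -big_split; apply: eq_bigr => k _ /=.
  by rewrite mderivD pevalD mulrDl.
ring.
Qed.

Let expansionM x d p q :
  expansion x d p -> expansion x d q -> expansion x d (p * q).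
Proof.
move=> [r rP] [s sP].
have gradM : dot (grad_at (p * q) x) d
    = dot (grad_at p x) d * peval q x + peval p x * dot (grad_at q x) d.
  rewrite !dot_grad_at mulr_suml mulr_sumr -big_split.
  apply: eq_bigr => k _ /=; rewrite mderivM pevalD !pevalM; ring.
set g := dot (grad_at p x) d in rP gradM.
set h := dot (grad_at q x) d in sP gradM.
(* All terms of order at least two in the product of the two expansions, divided by [t ^+ 2]. *)
exists ((peval p x)%:P * s + (peval q x)%:P * r + (g * h)%:P
        + 'X * (g%:P * s + h%:P * r) + 'X^2 * r * s) => t.
rewrite !pevalM rP sP gradM !hornerE; ring.
Qed.

Lemma peval_line p x d : exists r : {poly R}, forall t,
  peval p (x + t *: d)
  = peval p x + t * dot (grad_at p x) d + t ^+ 2 * r.[t].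
Proof.
elim/mpolyind: p => [|b m p _ _ IH]; first by rewrite -mpolyC0; apply: expansionC.
apply: expansionD => //; rewrite -mul_mpolyC; apply: expansionM.
  exact: expansionC.
rewrite mpolyXE_id; apply: (big_ind (expansion x d)) => [||k _].
- by rewrite -mpolyC1; apply: expansionC.
- exact: expansionM.
- elim: (m k) => [|e IHe]; first by rewrite expr0 -mpolyC1; apply: expansionC.
  by rewrite exprS; apply: expansionM.
Qed.

Lemma peval_line_bound p x d : exists2 M, 0 <= M & forall t, 0 <= t -> t <= 1 ->
  `|peval p (x + t *: d) - peval p x - t * dot (grad_at p x) d| <= t ^+ 2 * M.
Proof.
have [r rP] := peval_line p x d.
(* The sum of the absolute values of the coefficients bounds [r] on the unit interval. *)
exists (\sum_(i < size r) `|r`_i|) => [|t t0 t1]; first exact: sumr_ge0.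
have -> : peval p (x + t *: d) - peval p x - t * dot (grad_at p x) d
    = t ^+ 2 * r.[t] by rewrite rP; ring.
rewrite normrM ger0_norm ?exprn_ge0 // ler_wpM2l ?exprn_ge0 //.
rewrite horner_coef (le_trans (ler_norm_sum _ _ _)) // ler_sum // => i _.
by rewrite normrM ler_piMr // ger0_norm ?exprn_ge0 // exprn_ile1.
Qed.

Lemma peval_line_gt p x d : 0 < dot (grad_at p x) d ->
  exists2 e, 0 < e & forall t, 0 < t -> t <= e ->
    peval p x < peval p (x + t *: d).
Proof.
move=> g0; have [M M0 MP] := peval_line_bound p x d.
(* The increment is at least [t * (g - t * M)], with [g] the directional derivative. *)
have [e e0 eP] := @small_affine_gt0 _ _ (- M) g0.
exists (Num.min 1 e) => [|t t0]; first by rewrite lt_min ltr01.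
rewrite le_min => /andP[t1 te].
have := mulr_gt0 t0 (eP t t0 te).
have := MP t (ltW t0) t1; rewrite ler_norml => /andP[+ _].
rewrite expr2; lra.
Qed.

Lemma peval_line_gt0 p x d : 0 < peval p x ->
  exists2 e, 0 < e & forall t, 0 < t -> t <= e -> 0 < peval p (x + t *: d).
Proof.
move=> p0; have [M M0 MP] := peval_line_bound p x d.
have [e e0 eP] := @small_affine_gt0 _ _ (dot (grad_at p x) d - M) p0.
exists (Num.min 1 e) => [|t t0]; first by rewrite lt_min ltr01.
rewrite le_min => /andP[t1 te].
have := eP t t0 te.
have := MP t (ltW t0) t1; rewrite ler_norml => /andP[+ _].
(* For [t <= 1] the quadratic error is absorbed into the linear term, hence the slope [g - M]
   above. *)
have : t ^+ 2 * M <= t * M by rewrite ler_wpM2r // expr2 ger_pMl.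
lra.
Qed.

Lemma convex_mpoly_line p x y (t : R) : convex_mpoly p -> 0 <= t -> t <= 1 ->
  peval p (x + t *: (y - x)) <= peval p x + t * (peval p y - peval p x).
Proof.
move=> cp t0 t1.
have : peval p (t *: y + (1 - t) *: x) <= t * peval p y + (1 - t) * peval p x.
  exact: cp (Itv01 t0 t1) y x (in_setT _) (in_setT _).
rewrite (_ : t *: y + (1 - t) *: x = x + t *: (y - x)).
  by move=> /le_trans; apply; lra.
by rewrite scalerBl scale1r scalerBr addrC -!addrA [- _ + _]addrC.
Qed.

(** If the derivative exceeded the chord by a gap [g > 0], the expansion and convexity on the
    segment would give [t * (g - t * M) <= 0], which fails for small [t > 0]. *)
Lemma convex_mpoly_grad p x y : convex_mpoly p ->
  dot (grad_at p x) (y - x) <= peval p y - peval p x.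
Proof.
move=> cp; rewrite leNgt; apply/negP; rewrite -subr_gt0 => g0.
have [M M0 MP] := peval_line_bound p x (y - x).
have [e e0 eP] := @small_affine_gt0 _ _ (- M) g0.
pose t := Num.min 1 e; have t0 : 0 < t by rewrite lt_min ltr01.
have t1 : t <= 1 by rewrite ge_min lexx.
have te : t <= e by rewrite ge_min lexx orbT.
have := mulr_gt0 t0 (eP t t0 te).
have := MP t (ltW t0) t1; rewrite ler_norml => /andP[+ _].
have := convex_mpoly_line x y cp (ltW t0) t1.
rewrite expr2; lra.
Qed.

Lemma grad_atN p x : grad_at (- p) x = - grad_at p x.
Proof. by apply/colP => k; rewrite !mxE mderivN /peval mevalN. Qed.

Lemma concave_mpolyN p : concave_mpoly p -> convex_mpoly (- p).
Proof.
rewrite /concave_mpoly /convex_mpoly.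
by have -> : peval (- p) = (fun x => - peval p x)
  by apply/funext => x; rewrite /peval mevalN.
Qed.

Lemma concave_mpoly_grad p x y : concave_mpoly p ->
  peval p y - peval p x <= dot (grad_at p x) (y - x).
Proof.
move=> /concave_mpolyN /(convex_mpoly_grad x y).
rewrite grad_atN dotNl /peval !mevalN; lra.
Qed.

End Line.

(** * Fritz John conditions at weakly Pareto points *)

Section KKT.
Variables (R : realType) (n m l : nat).
Variables (f : 'I_m -> {mpoly R[n]}) (c : 'I_l -> {mpoly R[n]}).
Implicit Types (x : 'cV[R]_n) (w : 'I_m -> R) (y : 'I_l -> R).

(** A short step along [d] would stay feasible, as active constraints grow and inactive ones remain
    positive, while every objective drops. *)
Lemma weakly_pareto_no_descent x d : weakly_pareto_set f c x ->
  (forall j, dot (grad_at (f j) x) d < 0) ->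
  ~ (forall i, peval (c i) x = 0 -> 0 < dot (grad_at (c i) x) d).
Proof.
move=> [cx noy] fd cd; apply: noy.
have [j _|e e0 eP] := @small_forall _ _ (enum 'I_m)
    (fun j t => peval (f j) (x + t *: d) < peval (f j) x).
  have [|e e0 eP] := @peval_line_gt _ _ (- f j) x d.
    by rewrite grad_atN dotNl oppr_gt0.
  by exists e => // t t0 te; have := eP t t0 te; rewrite /peval !mevalN ltrN2.
have [i _|e' e'0 e'P] := @small_forall _ _ (enum 'I_l)
    (fun i t => 0 <= peval (c i) (x + t *: d)).
  have := cx i; rewrite le_eqVlt => /predU1P[ci0|ci0].
    have [e1 e10 e1P] := peval_line_gt (cd i (esym ci0)).
    by exists e1 => // t t0 te; rewrite ci0 ltW // e1P.
  have [e1 e10 e1P] := peval_line_gt0 d ci0.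
  by exists e1 => // t t0 te; rewrite ltW // e1P.
pose t := Num.min e e'; have t0 : 0 < t by rewrite lt_min e0.
exists (x + t *: d); split => [i|j].
  by apply: e'P; rewrite ?mem_enum // ge_min lexx orbT.
by apply: eP; rewrite ?mem_enum // ge_min lexx.
Qed.

Lemma weakly_pareto_fritz_john x : weakly_pareto_set f c x ->
  exists w y,
    [/\ forall j, 0 <= w j, forall i, 0 <= y i,
        forall i, y i * peval (c i) x = 0,
        \sum_j w j *: grad_at (f j) x = \sum_i y i *: grad_at (c i) x
      & (exists j, 0 < w j) \/ (exists i, 0 < y i)].
Proof.
move=> wpx.
(* Gordan's theorem is applied to all negated objective gradients together with the gradients of the
   active constraints only. *)
pose A : pred ('I_m + 'I_l) := fun k =>
  if k is inr i then peval (c i) x == 0 else true.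
pose a (k : 'I_m + 'I_l) : 'cV[R]_n := match k with
  | inl j => - grad_at (f j) x | inr i => grad_at (c i) x end.
have [[d dP]|[z [z0 [k kA zk] sum0]]] := gordan a (enum_uniq A).
  exfalso; apply: (@weakly_pareto_no_descent x d) => // [j|i ci0].
    have := dP (inl j); rewrite mem_enum unfold_in => /(_ isT).
    by rewrite dotNl oppr_gt0.
  by have := dP (inr i); rewrite mem_enum unfold_in /A ci0 eqxx; apply.
exists (z \o inl).
(* The value of [z] at an inactive constraint is arbitrary; replacing it by 0 yields
   complementarity. *)
exists (fun i => if peval (c i) x == 0 then z (inr i) else 0); split.
- by move=> j /=.
- by move=> i; case: ifP.
- by move=> i; case: eqP => [->|_]; rewrite ?mulr0 ?mul0r.
- move: sum0; rewrite big_enum big_sumType /=.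
  under eq_bigr do rewrite scalerN.
  rewrite sumrN addrC => /eqP; rewrite subr_eq0 => /eqP <-.
  rewrite big_mkcond; apply: eq_bigr => i _ /=.
  by rewrite unfold_in /A; case: ifP; rewrite ?scale0r.
- move: kA; rewrite mem_enum unfold_in; case: k zk => [j zj _|i zi /= ci].
    by left; exists j.
  by right; exists i; rewrite ci.
Qed.

(** * Recovering the multipliers through [C'] *)

Variable C' : 'M[{mpoly R[n]}]_(l, n + l).
Hypothesis C'C : C' *m constraint_mx c = 1%:M.

Local Notation ev x := (meval (fun k => (x : 'cV[R]_n) k 0)).


Lemma peval_u_poly x i j : peval (u_poly f C' i j) x
  = (map_mx (ev x) (lsubmx C') *m grad_at (f j) x) i 0.
Proof.
rewrite /u_poly /peval !mxE rmorph_sum; apply: eq_bigr => k _ /=.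
by rewrite !mxE rmorphM.
Qed.

(* [C' C = 1] at [x]: a multiplier vector is recovered from the gradient it
   produces. *)
Lemma multiplier_unique x y : (forall i, y i * peval (c i) x = 0) ->
  forall i, y i
    = (map_mx (ev x) (lsubmx C') *m \sum_i y i *: grad_at (c i) x) i 0.
Proof.
move=> yc i.
(* Complementarity kills the diagonal block, so only the first [n] columns of [C'] contribute. *)
have Cy : map_mx (ev x) (constraint_mx c) *m (\col_i y i)
    = col_mx (\sum_i y i *: grad_at (c i) x) 0.
  rewrite /constraint_mx map_col_mx mul_col_mx; congr col_mx.
    apply/colP => k; rewrite mxE summxE; apply: eq_bigr => i' _.
    by rewrite !mxE mulrC.
  rewrite map_diag_mx mul_diag_mx; apply/colP => i'.
  by rewrite !mxE mulrC; exact: yc.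
have := congr1 (fun M => (map_mx (ev x) M *m (\col_i y i)) i 0) C'C.
rewrite /= map_mxM -mulmxA Cy map_mx1 mul1mx [RHS]mxE => <-.
by rewrite -{1}[C']hsubmxK map_row_mx mul_row_col mulmx0 addr0.
Qed.

(** Stationarity replaces the constraint gradients in [multiplier_unique] by the objective
    gradients, and linearity in [w] produces the [u_poly] values. *)
Lemma multiplierE x w y : (forall i, y i * peval (c i) x = 0) ->
  \sum_j w j *: grad_at (f j) x = \sum_i y i *: grad_at (c i) x ->
  forall i, y i = \sum_j w j * peval (u_poly f C' i j) x.
Proof.
move=> yc eqg i; rewrite (multiplier_unique yc) -eqg mulmx_sumr summxE.
by apply: eq_bigr => j _; rewrite peval_u_poly -scalemxAr mxE.
Qed.

Lemma weakly_pareto_kkt x : weakly_pareto_set f c x ->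
  exists w y,
    [/\ forall j, 0 <= w j, forall i, 0 <= y i,
        forall i, y i * peval (c i) x = 0,
        \sum_j w j *: grad_at (f j) x = \sum_i y i *: grad_at (c i) x
      & \sum_j w j = 1].
Proof.
move=> /weakly_pareto_fritz_john[w [y [w0 y0 yc eqg nz]]].
have s0 : 0 < \sum_j w j.
  suff [j wj] : exists j, 0 < w j.
    by rewrite (bigD1 j) //= ltr_wpDr // sumr_ge0.
  (* A positive [y k] is a combination of the [w j], so these cannot all vanish. *)
  case: nz => [|[k]] //; rewrite (multiplierE yc eqg) => sk.
  apply/existsP; apply: contraTT sk; rewrite negb_exists => /forallP wn.
  rewrite -leNgt big1 // => j _; suff -> : w j = 0 by rewrite mul0r.
  by apply: le_anti; rewrite w0 leNgt wn.
set s := \sum_j w j in s0.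
exists (fun j => s^-1 * w j), (fun i => s^-1 * y i); split.
- by move=> j; rewrite mulr_ge0 // invr_ge0 ltW.
- by move=> i; rewrite mulr_ge0 // invr_ge0 ltW.
- by move=> i; rewrite -mulrA yc mulr0.
- under eq_bigr do rewrite -scalerA.
  under [RHS]eq_bigr do rewrite -scalerA.
  by rewrite -!scaler_sumr eqg.
- by rewrite -mulr_sumr mulVf // gt_eqF.
Qed.

(** * Recovering the weights through [P'], and sufficiency of the KKT system *)

Variable P' : 'M[{mpoly R[n]}]_(m, n + l + 1).
Hypothesis P'P : P' *m pareto_mx f c C' = 1%:M.

(* The KKT system says exactly [P(x) w = e_{n+l+1}]. *)
Lemma weight_unique x w y : (forall i, y i * peval (c i) x = 0) ->
  \sum_j w j *: grad_at (f j) x = \sum_i y i *: grad_at (c i) x ->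
  \sum_j w j = 1 -> forall j, w j = peval (w_poly P' j) x.
Proof.
move=> yc eqg w1 j; have yE := multiplierE yc eqg.
have Pw : map_mx (ev x) (pareto_mx f c C') *m (\col_j w j)
    = delta_mx (rshift (n + l) ord0) 0.
  have -> : delta_mx (rshift (n + l) ord0) 0
      = col_mx 0 (const_mx 1) :> 'cV[R]_(n + l + 1).
    apply/colP => k; rewrite !mxE; case: splitP => k' kk'; rewrite !mxE.
      by rewrite eqxx andbT -val_eqE /= kk' addn0 ltn_eqF.
    by rewrite -val_eqE /= kk' (ord1 k') !eqxx.
  (* The last row is the normalisation of [w]; after [y] is expressed through [w], the top block is
     stationarity and the middle block is complementarity. *)
  rewrite /pareto_mx !map_col_mx !mul_col_mx; congr col_mx; last first.
    apply/colP => k; rewrite !mxE -[RHS]w1; apply: eq_bigr => j' _.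
    by rewrite !mxE meval1 mul1r.
  rewrite -[RHS]col_mx0; congr col_mx; apply/colP => k; rewrite !mxE.
    transitivity ((\sum_i y i *: grad_at (c i) x
                   - \sum_j w j *: grad_at (f j) x) k 0); last first.
      by rewrite eqg subrr mxE.
    rewrite mxE [X in _ = _ + X]mxE !summxE.
    under [in RHS]eq_bigr do rewrite mxE yE mulr_suml.
    rewrite exchange_big -sumrB; apply: eq_bigr => j' _ /=.
    rewrite !mxE summxE rmorphB rmorph_sum mulrBl mulr_suml; congr (_ - _).
      by apply: eq_bigr => i _; rewrite !mxE rmorphM mulrC mulrA.
    by rewrite mulrC.
  rewrite -[RHS](yc k) yE mulr_suml; apply: eq_bigr => j' _.
  by rewrite !mxE rmorphM mulrC mulrA.
have := congr1 (fun M => (map_mx (ev x) M *m (\col_j w j)) j 0) P'P.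
rewrite /= map_mxM -mulmxA Pw map_mx1 mul1mx [RHS]mxE => <-.
by rewrite /w_poly /peval -colE -colE !mxE.
Qed.

Lemma peval_lambda_poly x i : peval (lambda_poly f C' P' i) x
  = \sum_j peval (w_poly P' j) x * peval (u_poly f C' i j) x.
Proof.
rewrite /peval rmorph_sum; apply: eq_bigr => j _; exact: rmorphM.
Qed.

(** Pairing stationarity with [z - x], for a feasible [z] better in every objective, gives a
    contradiction: concavity and complementarity make the constraint side nonnegative, convexity
    makes the objective side negative. *)
Lemma kkt_weakly_pareto x w y :
  (forall j, convex_mpoly (f j)) -> (forall i, concave_mpoly (c i)) ->
  \sum_j w j *: grad_at (f j) x = \sum_i y i *: grad_at (c i) x ->
  (forall i, [/\ 0 <= y i, 0 <= peval (c i) x & y i * peval (c i) x = 0]) ->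
  (forall j, 0 <= w j) -> \sum_j w j = 1 ->
  weakly_pareto_set f c x.
Proof.
move=> cf cc eqg yP w0 w1; split=> [i|[z [cz fz]]]; first by have [] := yP i.
have ge0 : 0 <= \sum_i y i * dot (grad_at (c i) x) (z - x).
  apply: sumr_ge0 => i _; have [yi _ yc] := yP i.
  apply: (@le_trans _ _ (y i * (peval (c i) z - peval (c i) x))).
    by rewrite mulrBr yc subr0 mulr_ge0.
  by rewrite ler_wpM2l // concave_mpoly_grad.
have le0 : \sum_j w j * dot (grad_at (f j) x) (z - x)
    <= \sum_j w j * (peval (f j) z - peval (f j) x).
  by apply: ler_sum => j _; rewrite ler_wpM2l // convex_mpoly_grad.
have lt0 : \sum_j w j * (peval (f j) z - peval (f j) x) < 0.
  have np j : w j * (peval (f j) z - peval (f j) x) <= 0.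
    by rewrite mulr_ge0_le0 // subr_le0 ltW.
  (* A zero sum of nonpositive terms would force every [w j] to vanish, against their sum being
     1. *)
  rewrite lt_neqAle sumr_le0 // andbT; apply/eqP => /eqP.
  rewrite -oppr_eq0 -sumrN psumr_eq0 => [/allP s0|j _]; last by rewrite oppr_ge0.
  have /eqP := w1; rewrite big1 => [|j _]; first by rewrite eq_sym oner_eq0.
  have /= := s0 j (mem_index_enum j).
  by rewrite oppr_eq0 mulf_eq0 subr_eq0 (lt_eqF (fz j)) orbF => /eqP.
have := congr1 (fun u => dot u (z - x)) eqg; rewrite /= !dot_suml.
under eq_bigr do rewrite dotZl.
under [RHS]eq_bigr do rewrite dotZl.
by move=> E; move: (le_lt_trans le0 lt0); rewrite E ltNge ge0.
Qed.

End KKT.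

(** * The two inclusions *)

Unset Implicit Arguments.

Theorem mainTheorem3 (R : realType) (n m l : nat)
    (f : 'I_m -> {mpoly R[n]}) (c : 'I_l -> {mpoly R[n]})
    (f_convex : forall j, convex_mpoly (f j))
    (c_concave : forall i, concave_mpoly (c i))
    (C_nonsingular : nonsingular_mpmx (constraint_mx c))
    (C' : 'M[{mpoly R[n]}]_(l, n + l))
    (C'C : C' *m constraint_mx c = 1%:M)
    (P_nonsingular : nonsingular_mpmx (pareto_mx f c C'))
    (P' : 'M[{mpoly R[n]}]_(m, n + l + 1))
    (P'P : P' *m pareto_mx f c C' = 1%:M) :
  let w j x := peval (w_poly P' j) x in
  let lambda i x := peval (lambda_poly f C' P' i) x in
  weakly_pareto_set f c =
  [set x : 'cV[R]_n |
    [/\ \sum_(j < m) w j x *: grad_at (f j) x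
          = \sum_(i < l) lambda i x *: grad_at (c i) x,
        forall i, [/\ 0 <= lambda i x, 0 <= peval (c i) x
                    & lambda i x * peval (c i) x = 0],
        forall j, 0 <= w j x
      & \sum_(j < m) w j x = 1]].
Proof.
move=> w lambda; apply/seteqP; split=> x /=.
  move=> wpx; have [cx _] := wpx.
  have [w' [y [w0 y0 yc eqg w1]]] := weakly_pareto_kkt C'C wpx.
  have wE j : w j x = w' j by rewrite (weight_unique C'C P'P yc eqg w1).
  have lE i : lambda i x = y i.
    rewrite (multiplierE C'C yc eqg) /lambda peval_lambda_poly.
    by apply: eq_bigr => j _; rewrite -wE.
  split.
  - by under eq_bigr do rewrite wE; under [RHS]eq_bigr do rewrite lE.
  - by move=> i; rewrite lE; split.
  - by move=> j; rewrite wE.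
  - by under eq_bigr do rewrite wE.
by case=> eqg lP w0 w1; apply: kkt_weakly_pareto eqg lP w0 w1.
Qed.
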